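(* The monoid $\mathrm{End}(\mathbb{Q},sep)$ has automatic homeomorphicity: for every countable set $\Omega$ and every monoid isomorphism $\theta$ from $\mathrm{End}(\mathbb{Q},sep)$ onto a closed submonoid of $Tr(\Omega)$, $\theta$ is a homeomorphism.
   Context: On $\mathbb{Q}$ let $circ(x,y,z)$ iff $x\le y\le z$ or $y\le z\le x$ or $z\le x\le y$, and let the (reflexive) separation relation be $sep(x,y,z,t)$ iff ($circ(x,y,z)\wedge circ(x,t,y)$) or ($circ(x,z,y)\wedge circ(x,y,t)$). $\mathrm{End}(\mathbb{Q},sep)$ is the monoid of all maps $f:\mathbb{Q}\to\mathbb{Q}$ (not necessarily injective) such that $sep(x,y,z,t)$ implies $sep(f(x),f(y),f(z),f(t))$. For a countable set $X$, $Tr(X)$ is the monoid of all maps $X\to X$. Transformation monoids carry the topology of pointwise convergence, whose basic open sets are $\{f : f(b_k)=c_k \text{ for } k=1,\dots,n\}$ for finite tuples of points. *)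

(* Defs.v *)
From HB Require Import structures.
From mathcomp Require Import all_boot all_order all_algebra.
From mathcomp Require Import boolp classical_sets functions cardinality.
From mathcomp Require Import topology.

Set Implicit Arguments.
Unset Strict Implicit.
Unset Printing Implicit Defensive.
Import Order.TTheory GRing.Theory Num.Theory.

Local Open Scope classical_set_scope.
Local Open Scope ring_scope.

(* The codomain is discrete, so this is the product of discrete spaces, whose
   topology has the sets {f | f b_k = c_k, k = 1..n} as a basis. In particular
   the order topology of the rationals plays no role here. *)
Definition Tr (X : countType) := {ptws X -> discrete_topology X}.

Definition submonoid (X : countType) (M : set (Tr X)) : Prop :=
  M idfun /\ (forall f g : Tr X, M f -> M g -> M (f \o g)).

(* Maps between subsets M of Tr X and N of Tr Y are represented by functions
   defined on all of Tr X, of which only the restriction to M is relevant. *)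
Definition monoid_isomorphism (X Y : countType) (M : set (Tr X))
    (N : set (Tr Y)) (theta : Tr X -> Tr Y) : Prop :=
  [/\ set_bij M N theta,
      theta idfun = idfun &
      forall f g : Tr X, M f -> M g -> theta (f \o g) = theta f \o theta g].

(* Continuity on a subset is for the subspace topology. The inverse g is
   determined on B by the first and third conditions. *)
Definition homeomorphism (S T : topologicalType) (A : set S) (B : set T)
    (f : S -> T) : Prop :=
  [/\ set_bij A B f,
      {within A, continuous f} &
      exists2 g : T -> S,
        (forall x, A x -> g (f x) = x) & {within B, continuous g}].

Definition automatic_homeomorphicity (X : countType) (M : set (Tr X)) : Prop :=
  forall (Omega : countType) (N : set (Tr Omega)) (theta : Tr X -> Tr Omega),
    submonoid N -> closed N -> monoid_isomorphism M N theta ->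
    homeomorphism M N theta.

Definition circ (x y z : rat) : bool :=
  [|| x <= y <= z, y <= z <= x | z <= x <= y].

Definition sep (x y z t : rat) : bool :=
  (circ x y z && circ x t y) || (circ x z y && circ x y t).

Definition End_sep : set (Tr rat) :=
  [set f : Tr rat |
    forall x y z t : rat, sep x y z t -> sep (f x) (f y) (f z) (f t)].

(* Main.v *)
(** Continuity of [theta] at a point [w] of [Omega] means that the class of a map
[f] under [kappa f := theta f w] depends on finitely many values of [f]. The
only facts needed are that [kappa] takes countably many values and that
[kappa f = kappa g] implies [kappa (h \o f) = kappa (h \o g)]. It suffices to
find a map [e] with finite image and [kappa e = kappa idfun], since maps [f] and
[g] that agree on the image of [e] then satisfy
[kappa f = kappa (f \o e) = kappa (g \o e) = kappa g].

Call an interval collapsible if some monotone [e] with [kappa e = kappa idfun]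
is the identity outside it and takes finitely many values on it. If an interval
is not collapsible, cutting it at the successive rationals gives a decreasing
sequence of intervals [I n], none collapsible, with no rational in common. For
every binary sequence [s] there is a monotone embedding [f s] of the line that
squeezes [I n] into its left or right half according to [s n], for all [n] at
once, and, except for countably many [s], it has a monotone left inverse [h s].
By Cantor's theorem, [kappa (f s) = kappa (f t)] for some [s <> t]. Then
[kappa (h s \o f t) = kappa idfun], but [h s \o f t] sends [I n] to a point,
where [n] is the first place where [s] and [t] differ: a contradiction.

So bounded intervals are collapsible. Monotone maps cannot move the end of the
line, but [sep] does not see it: the line embeds in a bounded interval by a map
that preserves the circular order, moves the end to an irrational cut and has a
left inverse in the monoid. Conjugating by this map yields [e].

For the inverse of [theta], the constant maps [cst b] satisfy
[f \o cst b = cst (f b)], and some [w] separates all the [theta (cst b)]. *)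

Require Import Defs.
From mathcomp Require Import all_boot all_order all_algebra.
From mathcomp Require Import boolp classical_sets functions cardinality topology.
From mathcomp Require Import ring lra.

Set Implicit Arguments.
Unset Strict Implicit.
Unset Printing Implicit Defensive.
Import Order.TTheory GRing.Theory Num.Theory.

Local Open Scope classical_set_scope.
Local Open Scope ring_scope.

(** * Neighbourhoods and limits in the topology of pointwise convergence *)

Lemma nbhs_Tr_eval (X : countType) (f : Tr X) (x : X) :
  nbhs f [set g : Tr X | g x = f x].
Proof.
have := @proj_continuous X (fun=> discrete_topology X) x f [set f x].
by apply; exact: discrete_set1.
Qed.

Lemma nbhs_Tr_eq_on (X : countType) (f : Tr X) (s : seq X) :
  nbhs f [set g : Tr X | forall x, x \in s -> g x = f x].
Proof.
elim: s => [|x s IH]; first by apply: filterS filterT => g _ x.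
apply: filterS (filterI (nbhs_Tr_eval f x) IH) => g [/= gx gs] y.
by rewrite inE => /predU1P[->|/gs].
Qed.

Lemma cvg_Tr (X : countType) (F : set_system (Tr X)) (f : Tr X) :
  Filter F -> (forall x, F [set g | g x = f x]) -> F --> f.
Proof.
move=> FF Ff; apply/cvg_sup => x U [V] [[W] oW <-] /= Wf WU.
by apply: (filterS WU); apply: filterS (Ff x) => g /= gx; rewrite /= gx.
Qed.

Lemma within_cvg_Tr (T : topologicalType) (X : countType) (M : set T)
    (g : T -> Tr X) :
    (forall f, M f -> forall x, nbhs f [set h | M h -> g h x = g f x]) ->
  {within M, continuous g}.
Proof.
by move=> H; apply/subspace_continuousP => f Mf; apply: cvg_Tr => x; exact: H.
Qed.

(** * Monotone maps, Cantor's diagonal and stabilizing sequences *)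

Definition nondecr (f : rat -> rat) := {homo f : x y / x <= y}.

Lemma cantor_collision (T : countType) (c : (nat -> bool) -> T) :
  exists s t, s <> t /\ c s = c t.
Proof.
apply: contrapT => noc.
have c_inj s t : c s = c t -> s = t.
  by move=> cst; apply: contrapT => st; apply: noc; exists s, t.
(* The diagonal sequence: with [c] injective, [d] at the code of [c d] is the negation of itself. *)
pose d n := `[< exists s, pickle (c s) = n /\ s n = false >].
case dn: (d (pickle (c d))).
  move/asboolP: (dn) => [s [/(pcan_inj pickleK)/c_inj -> ds]].
  by rewrite dn in ds.
by have /asboolP := negbT dn; apply; exists d.
Qed.

Lemma stable_limit (G : nat -> rat -> rat) :
    (forall n, nondecr (G n)) ->
    (forall x, exists N, forall n, (N <= n)%N -> G n x = G N x) ->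
  exists2 g, nondecr g & forall x, exists N, forall n, (N <= n)%N -> g x = G n x.
Proof.
move=> Gmono /choice[N GN]; exists (fun x => G (N x) x) => [x y xy|x].
  rewrite -(GN x (maxn (N x) (N y))) ?leq_maxl//.
  by rewrite -(GN y (maxn (N x) (N y))) ?leq_maxr//; exact: Gmono.
by exists (N x) => n /GN.
Qed.

(** * Squeezing an interval into one of its halves *)

Definition contract (right : bool) (a b x : rat) : rat :=
  if a < x < b then (x + (if right then b else a)) / 2 else x.

(** A left inverse of [contract], made total and monotone by clamping: the half that [contract]
    misses goes to an end of the interval. *)
Definition expand (right : bool) (a b x : rat) : rat :=
  if a < x < b then
    if right then Num.max (2 * x - b) a else Num.min (2 * x - a) b
  else x.

Lemma contract_nondecr r a b : nondecr (contract r a b).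
Proof.
move=> x y; rewrite /contract.
by case: r; case: ifPn; case: ifPn; rewrite ?negb_and -?leNgt; lra.
Qed.

Lemma expand_nondecr r a b : nondecr (expand r a b).
Proof.
move=> x y; rewrite /expand.
by case: r; case: ifPn; case: ifPn; rewrite ?negb_and -?leNgt /Num.max /Num.min;
  do ?[case: ifPn]; rewrite -?leNgt; lra.
Qed.

Lemma contract_out r a b x : ~~ (a < x < b) -> contract r a b x = x.
Proof. by rewrite /contract => /negbTE ->. Qed.

Lemma expand_out r a b x : ~~ (a < x < b) -> expand r a b x = x.
Proof. by rewrite /expand => /negbTE ->. Qed.

Lemma contract_in r a b x : a < x < b -> a < contract r a b x < b.
Proof. by move=> abx; rewrite /contract abx; case: r; lra. Qed.

Lemma contractK r a b : cancel (contract r a b) (expand r a b).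
Proof.
move=> x; have [abx|abx] := boolP (a < x < b); last first.
  by rewrite contract_out// expand_out.
rewrite /expand contract_in// /contract abx /Num.max /Num.min.
by case: r; case: ifPn; rewrite -?leNgt; lra.
Qed.

Lemma expand_contractN r a b x : a < x < b ->
  expand r a b (contract (~~ r) a b x) = if r then a else b.
Proof.
move=> abx; rewrite /expand contract_in// /contract abx /Num.max /Num.min.
by case: r => /=; case: ifPn; rewrite -?leNgt; lra.
Qed.

(** Such a point would lie in both open halves of the interval. *)
Lemma expand_disjoint a b x :
  a < expand true a b x < b -> a < expand false a b x < b -> ~~ (a < x < b).
Proof.
rewrite /expand; case: ifPn => // abx.
by rewrite /Num.max /Num.min; do 2![case: ifPn]; rewrite -?leNgt; lra.
Qed.

(** * Nested intervals with no common rational *)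

Section NestedIntervals.
Variables a b : nat -> rat.
Hypothesis nested : forall n x, a n.+1 < x < b n.+1 -> a n < x < b n.
Hypothesis avoid : forall x, ~~ (a (pickle x).+1 < x < b (pickle x).+1).

(** The innermost interval is contracted first, so passing from [n] to [n.+1] changes values only on
    the [n]th interval. [expansions] undoes this from the outermost interval inwards. *)
Fixpoint contractions (s : nat -> bool) n x :=
  if n is m.+1 then contractions s m (contract (s m) (a m) (b m) x) else x.

Fixpoint expansions (s : nat -> bool) n x :=
  if n is m.+1 then expand (s m) (a m) (b m) (expansions s m x) else x.

Lemma nested_le m n x : (m <= n)%N -> a n < x < b n -> a m < x < b m.
Proof.
move=> /subnKC <-; elim: (n - m)%N => [|k IH]; first by rewrite addn0.
by rewrite addnS => /nested.
Qed.

Lemma contractions_nondecr s n : nondecr (contractions s n).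
Proof. by elim: n => [|n IH] x y xy //=; apply/IH/contract_nondecr. Qed.

Lemma expansions_nondecr s n : nondecr (expansions s n).
Proof. by elim: n => [|n IH] x y xy //=; apply/expand_nondecr/IH. Qed.

Lemma contractionsK s n : cancel (contractions s n) (expansions s n).
Proof. by elim: n => [|n IH] x //=; rewrite IH contractK. Qed.

Lemma contractions_stable s m n x : (m <= n)%N -> ~~ (a m < x < b m) ->
  contractions s n x = contractions s m x.
Proof.
move=> /subnKC <- xm; elim: (n - m)%N => [|k IH]; first by rewrite addn0.
rewrite addnS /= contract_out//.
by apply: contra xm; apply: nested_le; rewrite leq_addr.
Qed.

Lemma expansions_stable s m n x : (m <= n)%N ->
    ~~ (a m < expansions s m x < b m) ->
  expansions s n x = expansions s m x.
Proof.
move=> /subnKC <- xm; elim: (n - m)%N => [|k IH]; first by rewrite addn0.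
rewrite addnS /= expand_out// IH.
by apply: contra xm; apply: nested_le; rewrite leq_addr.
Qed.

(** The contractions of index above [m] act first and map the [m]th interval into itself, so they
    merely move [x] inside it. *)
Lemma contractions_tail s m k x : a m < x < b m ->
  exists2 y, a m < y < b m &
    contractions s (m.+1 + k) x = contractions s m.+1 y.
Proof.
elim: k x => [|k IH] x xm; first by exists x; rewrite ?addn0.
rewrite addnS [contractions s (_.+1) x]/=; apply: IH.
have [xk|xk] := boolP (a (m.+1 + k)%N < x < b (m.+1 + k)%N).
  by apply: (@nested_le m (m.+1 + k)); [rewrite addSnnS leq_addr|exact: contract_in].
by rewrite contract_out.
Qed.

Lemma eq_contractions s t n : (forall k, (k < n)%N -> s k = t k) ->
  contractions s n =1 contractions t n.
Proof.
elim: n => [//|n IH] st x /=; rewrite st//.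
by apply: IH => k kn; apply: st; exact: ltnW.
Qed.

Lemma eq_expansions s t n : (forall k, (k < n)%N -> s k = t k) ->
  expansions s n =1 expansions t n.
Proof.
elim: n => [//|n IH] st x /=; rewrite st// IH// => k kn.
by apply: st; exact: ltnW.
Qed.

Lemma first_difference (s t : nat -> bool) : s <> t ->
  exists2 n, s n != t n & forall k, (k < n)%N -> s k = t k.
Proof.
move=> st; have ex : exists n, s n != t n.
  apply: contrapT => no; apply: st; apply/funext => n.
  by apply/eqP; apply: contrapT => /negP nst; apply: no; exists n.
case: (ex_minnP ex) => n stn nmin; exists n => // k kn.
by apply/eqP; apply: contraTT kn => /nmin; rewrite -leqNgt.
Qed.

(* [y] stays in all intervals when the choices [s] are undone: it lies in the
   cut to which the images of the intervals shrink. *)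
Definition at_limit s y := forall n, a n < expansions s n y < b n.

Lemma at_limit_inj s t y : at_limit s y -> at_limit t y -> s = t.
Proof.
move=> sy ty; apply: contrapT => /first_difference[n stn stlt].
have /negP := ty n; apply.
move: (sy n.+1) (ty n.+1) stn => /= /nested + /nested.
rewrite (eq_expansions stlt).
by case: (s n); case: (t n) => //= u v _; apply/negP;
  [exact: expand_disjoint u v|exact: expand_disjoint v u].
Qed.

Variables (C : countType) (kappa : (rat -> rat) -> C).
Hypothesis kappaP : forall h f g, nondecr h -> nondecr f -> nondecr g ->
  kappa f = kappa g -> kappa (h \o f) = kappa (h \o g).

Lemma nested_collapse : exists n e c,
  [/\ nondecr e, kappa e = kappa idfun,
      forall x, ~~ (a n < x < b n) -> e x = x &
      forall x, a n < x < b n -> e x = c].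
Proof.
have /choice[f fP] : forall s, exists f, nondecr f /\
    forall x, exists N, forall n, (N <= n)%N -> f x = contractions s n x.
  move=> s; have [||f] := @stable_limit (contractions s).
  - exact: contractions_nondecr.
  - move=> x; exists (pickle x).+1 => n xn.
    by apply: contractions_stable xn _; exact: avoid.
  by exists f.
have /choice[h hP] : forall s, exists h, (~ exists y, at_limit s y) ->
    nondecr h /\ forall x, exists N, forall n, (N <= n)%N -> h x = expansions s n x.
  move=> s; have [|nos] := pselect (exists y, at_limit s y); first by exists idfun.
  have [||h] := @stable_limit (expansions s); last by exists h.
  - exact: expansions_nondecr.
  move=> x; apply: contrapT => nox; apply: nos; exists x => n; apply: contrapT.
  by move=> /negP xn; apply: nox; exists n => m nm; exact: expansions_stable.
(* A sequence with a point at its limit may lack the inverse [h s]. Its color is such a point, which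
   determines it, so a collision must involve two sequences without one. *)
pose c s : (rat + C)%type :=
  if pselect (exists y, at_limit s y) is left ex then inl (projT1 (cid ex))
  else inr (kappa (f s)).
have [s [t [st]]] := cantor_collision c.
rewrite /c; case: pselect => [sl|/hP[hmono hlim]]; case: pselect => // ?.
  case: cid => y sy; case: cid => z tz /= [yz].
  by rewrite -yz in tz; case: st; exact: at_limit_inj sy tz.
move=> [fst]; have [n stn stlt] := first_difference st.
have [fsmono fslim] := fP s; have [ftmono ftlim] := fP t.
(* Expanding the half chosen by [s] sends the other half, where [f t] puts the [n]th interval, to
   this end. *)
exists n, (h s \o f t), (if s n then a n else b n); split.
- by move=> x y xy; apply/hmono/ftmono.
- rewrite -(kappaP hmono fsmono ftmono fst); congr kappa; apply/funext => x /=.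
  have [N fsx] := fslim x; have [M hfx] := hlim (f s x).
  rewrite (hfx (maxn M N)) ?leq_maxl// (fsx (maxn M N)) ?leq_maxr//.
  exact: contractionsK.
- move=> x xn /=; have [N ftx] := ftlim x; have [M hfx] := hlim (f t x).
  pose K := maxn M (maxn N n).
  have nK : (n <= K)%N by rewrite !leq_max leqnn !orbT.
  rewrite (hfx K) ?leq_maxl// (ftx K); last by rewrite !leq_max leqnn orbT.
  rewrite (contractions_stable t nK xn) -(eq_contractions stlt).
  by rewrite -(contractions_stable s nK xn) contractionsK.
move=> x xn /=; have [N ftx] := ftlim x; have [M hfx] := hlim (f t x).
have [y yn fty] := contractions_tail t N xn.
rewrite (ftx (n.+1 + N)%N) ?leq_addl// fty in hfx.
rewrite (ftx (n.+1 + N)%N) ?leq_addl// fty (hfx (maxn M n.+1)) ?leq_maxl//.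
have hfy : expansions s n.+1 (contractions t n.+1 y) = if s n then a n else b n.
  rewrite /= -(eq_contractions stlt) contractionsK -(expand_contractN (s n) yn).
  by move: stn; case: (s n); case: (t n).
(* An end of the [n]th interval is not strictly inside it, hence not inside the next one, and later
   expansions fix it. *)
rewrite (@expansions_stable s n.+1) ?leq_maxr// hfy.
apply/negP => /nested; by case: (s n); rewrite ltxx ?andbF.
Qed.
End NestedIntervals.

(** * Collapsing bounded intervals *)

Section CollapseInterval.
Variables (C : countType) (kappa : (rat -> rat) -> C).
Hypothesis kappaP : forall h f g, nondecr h -> nondecr f -> nondecr g ->
  kappa f = kappa g -> kappa (h \o f) = kappa (h \o g).

Definition collapsible (a b : rat) := exists e (s : seq rat),
  [/\ nondecr e, kappa e = kappa idfun,
      forall x, ~~ (a < x < b) -> e x = x &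
      forall x, a < x < b -> e x \in s].

(** Collapse the right piece first: [d] is monotone and fixes [x], so it maps that piece to points
    at or above [x], which [e] fixes. *)
Lemma collapsible_split a x b : a < x < b ->
  collapsible a x -> collapsible x b -> collapsible a b.
Proof.
move=> /andP[ax xb] [e [s [emono eid eout ein]]] [d [t [dmono did dout din]]].
exists (e \o d), (e x :: s ++ t); split.
- by move=> y z yz; apply/emono/dmono.
- by rewrite (kappaP emono dmono _ did) -?eid.
- move=> y aby /=.
  by rewrite dout ?eout; move: aby; rewrite ?negb_and -?leNgt; lra.
move=> y aby /=; case: (ltgtP y x) => [yx|xy|->].
- rewrite dout; last by rewrite negb_and -?leNgt; lra.
  by rewrite inE mem_cat ein ?orbT//; lra.
- have xdy : x <= d y by rewrite -{1}(dout x) ?dmono ?ltW// ltxx.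
  have -> : e (d y) = d y by rewrite eout// negb_and -!leNgt xdy orbT.
  by rewrite inE mem_cat din ?orbT//; lra.
- by rewrite dout ?inE ?eqxx// ltxx.
Qed.

Lemma collapse_interval a b : collapsible a b.
Proof.
apply: contrapT => nab.
(* Stage [n] cuts at the rational with code [n], if it lies inside, and keeps a piece that is not
   collapsible. *)
have /choice[step stepP] : forall px : (rat * rat) * nat, exists q : rat * rat,
    ~ collapsible px.1.1 px.1.2 -> [/\ ~ collapsible q.1 q.2,
      forall y, q.1 < y < q.2 -> px.1.1 < y < px.1.2 &
      forall x, pickle x = px.2 -> ~~ (q.1 < x < q.2)].
  move=> [[c d] n] /=.
  have [[x xn]|nox] := pselect (exists x : rat, pickle x = n).
  - have eqx y : pickle y = n -> y = x by rewrite -xn => /(pcan_inj pickleK).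
    have [cxd|cxd] := boolP (c < x < d); last first.
      by exists (c, d) => ncd; split=> // y /eqx ->.
    have [cx|ncx] := pselect (collapsible c x).
      exists (x, d) => ncd; split=> [xd|y /= xyd|y /eqx -> /=].
      + by apply: ncd; exact: (collapsible_split cxd).
      + by lra.
      + by rewrite ltxx.
    exists (c, x) => ncd; split=> [//|y /= xyd|y /eqx -> /=].
    + by lra.
    + by rewrite ltxx andbF.
  - by exists (c, d) => ncd; split=> // y yn; case: nox; exists y.
pose ab := fix ab n := if n is m.+1 then step (ab m, m) else (a, b).
have nabn n : ~ collapsible (ab n).1 (ab n).2.
  by elim: n => [//|n /(stepP (ab n, n))[]].
have [||n [e [c [emono eid eout ein]]]] :=
    @nested_collapse (fun n => (ab n).1) (fun n => (ab n).2) _ _ C kappa kappaP.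
- by move=> n x; have [_ + _] := stepP (ab n, n) (nabn n); apply.
- move=> x; have [_ _] := stepP (ab (pickle x), pickle x) (nabn (pickle x)).
  exact.
apply: (nabn n); exists e, [:: c]; split=> // x /ein ->.
by rewrite inE.
Qed.

End CollapseInterval.

(** * Maps that exchange the two sides of a cut preserve separation *)

Lemma rotation_End_sep (D : pred rat) (f : rat -> rat) :
    (forall x y, x <= y -> D y -> D x) ->
    (forall x y, x <= y -> D x = D y -> f x <= f y) ->
    (forall x y, D x -> ~~ D y -> f y <= f x) ->
  End_sep f.
Proof.
move=> Ddown fmono fcross.
have fcirc x y z : circ x y z -> circ (f x) (f y) (f z).
  (* The position of the cut [D] among the three points decides which cyclic rotation of the order
     holds for the images. *)
  have lecirc u v w : u <= v <= w ->
      [|| f u <= f v <= f w, f v <= f w <= f u | f w <= f u <= f v].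
    move=> /andP[uv vw].
    have := fmono _ _ uv; have := fmono _ _ vw; have := fcross u w.
    case Dw: (D w).
      by rewrite (Ddown _ _ uv) (Ddown _ _ vw Dw)// => _ -> // ->.
    case Dv: (D v).
      by rewrite (Ddown _ _ uv Dv) => -> // _ -> //; rewrite !orbT.
    by case: (D u) => /= [-> // -> // _|_ -> // -> //]; rewrite orbT.
  rewrite /circ => /or3P[] /lecirc; first by [].
    by case/or3P => ->; rewrite ?orbT.
  by case/or3P => ->; rewrite ?orbT.
move=> x y z t; rewrite /sep.
by case/orP => /andP[/fcirc -> /fcirc ->]; rewrite ?orbT.
Qed.

Lemma nondecr_End_sep f : nondecr f -> End_sep f.
Proof.
move=> fmono; apply: (@rotation_End_sep xpredT) => // x y xy _.
exact: fmono.
Qed.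

(** * Piecewise linear maps with infinitely many pieces *)

Section PiecewiseLinear.
Implicit Types u v : nat -> rat.

Lemma locate u x m : u 0 <= x < u m -> exists n, u n <= x < u n.+1.
Proof.
move=> /andP[u0x xm]; have ex : exists m, x < u m by exists m.
case: (ex_minnP ex) => -[|n] xn nmin; first by rewrite ltNge u0x in xn.
exists n; rewrite xn andbT leNgt; apply/negP => /nmin.
by rewrite ltnn.
Qed.

Definition locus u x : nat :=
  if pselect (exists n, u n <= x < u n.+1) is left ex then projT1 (cid ex)
  else 0%N.

(** For increasing [u] and [v], the affine interpolation that sends each [u n] to [v n]. *)
Definition plin u v x :=
  let n := locus u x in v n + (x - u n) * ((v n.+1 - v n) / (u n.+1 - u n)).

Lemma locusP u x n : {homo u : m n / (m < n)%N >-> m < n} ->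
  u n <= x < u n.+1 -> locus u x = n.
Proof.
move=> umono xn; rewrite /locus; case: pselect => [ex|[]]; last by exists n.
case: cid => m /= /andP[mx xm]; have /andP[nx xSn] := xn.
have ule : {homo u : i j / (i <= j)%N >-> i <= j} := ltW_homo umono.
apply/eqP; rewrite eqn_leq.
apply/andP; split; rewrite leqNgt; apply/negP => /ule h.
  by have := le_lt_trans (le_trans h mx) xSn; rewrite ltxx.
by have := le_lt_trans (le_trans h nx) xm; rewrite ltxx.
Qed.

Variables (u v : nat -> rat).
Hypothesis (umono : {homo u : m n / (m < n)%N >-> m < n}).
Hypothesis (vmono : {homo v : m n / (m < n)%N >-> m < n}).

Lemma plin_in n x : u n <= x < u n.+1 -> v n <= plin u v x < v n.+1.
Proof.
move=> xn; rewrite /plin (locusP umono xn).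
have u_gt0 : 0 < u n.+1 - u n by rewrite subr_gt0 umono.
have v_gt0 : 0 < v n.+1 - v n by rewrite subr_gt0 vmono.
have /andP[x1 x2] := xn.
rewrite lerDl mulr_ge0 ?subr_ge0 ?divr_ge0 ?(ltW v_gt0) ?(ltW u_gt0)//=.
rewrite -ltrBrDl mulrCA gtr_pMr// ltr_pdivrMr// mul1r ltrD2r//.
Qed.

Lemma plin_nondecr x y n : u 0 <= x -> x <= y -> y < u n -> plin u v x <= plin u v y.
Proof.
move=> ux xy yn.
have [|i xi] := @locate u x n; first by rewrite ux (le_lt_trans xy).
have [|j yj] := @locate u y n; first by rewrite (le_trans ux).
have : (i <= j)%N.
  rewrite leqNgt; apply/negP => /(ltW_homo umono) /= h.
  have /andP[] := xi; have /andP[_] := yj; lra.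
rewrite leq_eqVlt => /predU1P[ij|ij].
  subst j; rewrite /plin (locusP umono xi) (locusP umono yj) lerD2l.
  rewrite ler_wpM2r ?lerD2r//.
  by rewrite divr_ge0// subr_ge0 ltW ?umono ?vmono.
have /andP[_ /ltW h1] := plin_in xi; have /andP[h2 _] := plin_in yj.
apply: (le_trans h1); apply: le_trans h2.
exact: (ltW_homo vmono).
Qed.
End PiecewiseLinear.

Lemma plinK u v m x : {homo u : m n / (m < n)%N >-> m < n} ->
    {homo v : m n / (m < n)%N >-> m < n} ->
  u 0 <= x < u m -> plin v u (plin u v x) = x.
Proof.
move=> umono vmono /locate[n xn]; have yn := plin_in umono vmono xn.
rewrite {1}/plin (locusP vmono yn) /plin (locusP umono xn).
have : 0 < u n.+1 - u n by rewrite subr_gt0 umono.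
have : 0 < v n.+1 - v n by rewrite subr_gt0 vmono.
by move=> /lt0r_neq0 v0 /lt0r_neq0 u0; field; rewrite v0 u0.
Qed.

(** * An irrational cut, and winding the line around it *)

Lemma irrational_cut : exists l r : nat -> rat,
  [/\ {homo l : m n / (m < n)%N >-> m < n},
      {homo r : m n / (m < n)%N >-> n < m},
      forall m n, l m < r n &
      forall x, exists n, x < l n \/ r n < x].
Proof.
pose enum n : rat := odflt 0 (unpickle n).
(* The new interval lies strictly inside the old one, in the half away from [x], with both ends off
   the midpoint. *)
pose step (p : rat * rat) x := let d := p.2 - p.1 in
  if x <= p.1 + d / 2 then (p.1 + d * (2 / 3), p.1 + d * (5 / 6))
  else (p.1 + d / 6, p.1 + d / 3).
pose p := fix p n := if n is m.+1 then step (p m) (enum m) else (0, 1) : rat * rat.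
have stepP q x : q.1 < q.2 -> [/\ q.1 < (step q x).1, (step q x).1 < (step q x).2,
    (step q x).2 < q.2 & x < (step q x).1 \/ (step q x).2 < x].
  by rewrite /step; case: ifPn; rewrite -?ltNge => /= xq q12; split;
    [lra|lra|lra|left; lra|lra|lra|lra|right; lra].
have p12 n : (p n).1 < (p n).2.
  by elim: n => [//|n /(@stepP _ (enum n))[]].
have lmono : {homo (fun n => (p n).1) : m n / (m < n)%N >-> m < n}.
  by apply: homo_ltn lt_trans _ => n; have [] := stepP (p n) (enum n) (p12 n).
have rmono : {homo (fun n => (p n).2) : m n / (m < n)%N >-> n < m}.
  apply: (homo_ltn (fun _ _ _ h1 h2 => lt_trans h2 h1)) => n.
  by have [] := stepP (p n) (enum n) (p12 n).
exists (fun n => (p n).1), (fun n => (p n).2); split=> //.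
  move=> m n; have [mn|nm] := ltnP m n.
    exact: lt_trans (lmono _ _ mn) (p12 n).
  apply: (lt_le_trans (p12 m)); move: nm; rewrite leq_eqVlt => /predU1P[->//|].
  by move=> /rmono/ltW.
move=> x; exists (pickle x).+1.
by have [_ _ _] := stepP (p (pickle x)) (enum (pickle x)) (p12 _);
  rewrite {1 4}/enum pickleK.
Qed.

Section Rotation.
Variables l r : nat -> rat.
Hypothesis lmono : {homo l : m n / (m < n)%N >-> m < n}.
Hypothesis rmono : {homo r : m n / (m < n)%N >-> n < m}.
Hypothesis lr : forall m n, l m < r n.
Hypothesis lr_cut : forall x, exists n, x < l n \/ r n < x.

Let natq (n : nat) : rat := n%:R.
Let natq_mono : {homo natq : m n / (m < n)%N >-> m < n}.
Proof. by move=> m n mn; rewrite /natq ltr_nat. Qed.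
Let Nr n := - r n.
Let Nr_mono : {homo Nr : m n / (m < n)%N >-> m < n}.
Proof. by move=> m n /rmono; rewrite /Nr ltrN2. Qed.

Let natq_bound x : exists n, x < natq n.
Proof.
exists (Num.bound `|x|); apply: le_lt_trans (ler_norm x) _.
by apply: archi_boundP.
Qed.

(* Winds the line around the circle so that its end sits in the cut. *)
Definition wind x : rat := if x < 0 then - plin natq Nr (- x) else plin natq l x.

(** Points below [l 0] or above [r 0] are missed by [wind]; they all go to 0, where [wind] breaks
    the line. *)
Definition unwind_half (u : nat -> rat) y : rat :=
  if y < u 0%N then 0 else plin u natq y.

Definition unwind y : rat :=
  if `[< exists n, y < l n >] then unwind_half l y else - unwind_half Nr (- y).

Lemma unwind_half_ge0 u n y : {homo u : m n / (m < n)%N >-> m < n} -> y < u n ->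
  0 <= unwind_half u y.
Proof.
move=> umono yn; rewrite /unwind_half; case: ltP => // u0.
have [|m /(plin_in umono natq_mono)/andP[+ _]] := @locate u y n; first by rewrite u0.
exact: le_trans (ler0n _ m).
Qed.

Lemma unwind_half_nondecr u n x y : {homo u : m n / (m < n)%N >-> m < n} ->
  y < u n -> x <= y -> unwind_half u x <= unwind_half u y.
Proof.
move=> umono yn xy; have := unwind_half_ge0 umono yn; rewrite /unwind_half.
case: (ltP x) => [xu|ux]//; case: ltP => [yu|uy]; last first.
  by rewrite (plin_nondecr umono natq_mono ux xy yn).
by have := le_lt_trans ux (le_lt_trans xy yu); rewrite ltxx.
Qed.

Lemma unwind_half_plin u x : {homo u : m n / (m < n)%N >-> m < n} -> 0 <= x ->
  unwind_half u (plin natq u x) = x.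
Proof.
move=> umono x0; have [n xn] := natq_bound x.
have nx : natq 0 <= x < natq n by rewrite x0.
rewrite /unwind_half (plinK natq_mono umono nx); case: ltP => // xu.
have [m /(plin_in natq_mono umono)/andP[+ _]] := locate nx.
have := ltW_homo umono (leq0n m) => /= u0m /(le_trans u0m).
by rewrite leNgt xu.
Qed.

Lemma plin_nat_in u x : {homo u : m n / (m < n)%N >-> m < n} -> 0 <= x ->
  exists n, u 0%N <= plin natq u x < u n.
Proof.
move=> umono x0; have [n xn] := natq_bound x.
have nx : natq 0 <= x < natq n by rewrite x0.
have [m /(plin_in natq_mono umono)/andP[um mu]] := locate nx.
exists m.+1; rewrite mu andbT; apply: le_trans um.
exact: (ltW_homo umono (leq0n m)).
Qed.

Lemma windK : cancel wind unwind.
Proof.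
move=> x; rewrite /wind; case: ltP => x0; rewrite /unwind.
  have Nx : 0 <= - x by rewrite oppr_ge0 ltW.
  have [n /andP[_ nr]] := plin_nat_in Nr_mono Nx.
  rewrite ifN ?opprK ?unwind_half_plin ?opprK//.
  apply/asboolPn => -[m h]; have := lr m n; rewrite /Nr in nr; lra.
have [n /andP[_ nl]] := plin_nat_in lmono x0.
by rewrite ifT ?unwind_half_plin//; apply/asboolP; exists n.
Qed.

Lemma wind_bounded x : l 0%N - 1 < wind x < r 0%N + 1.
Proof.
rewrite /wind; case: (ltP x 0) => x0.
  have Nx : 0 <= - x by rewrite oppr_ge0 ltW.
  have [n] := plin_nat_in Nr_mono Nx; have := lr 0 n; rewrite /Nr; lra.
have [n] := plin_nat_in lmono x0; have := lr n 0; lra.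
Qed.

Lemma wind_End_sep : End_sep wind.
Proof.
apply: (@rotation_End_sep (fun x => x < 0)).
- by move=> x y xy y0; exact: le_lt_trans y0.
- move=> x y xy /= Dxy; rewrite /wind Dxy; case: (ltP y 0) => y0.
    have [n xn] := natq_bound (- x).
    by rewrite lerN2 (@plin_nondecr natq Nr natq_mono Nr_mono _ _ n)//
      ?lerN2// /natq oppr_ge0 ltW.
  have x0 : 0 <= x by rewrite leNgt Dxy ltNge y0.
  have [n yn] := natq_bound y.
  by have := plin_nondecr natq_mono lmono x0 xy yn.
- move=> x y /= x0; rewrite -leNgt => y0; rewrite /wind x0 ltNge y0 /=.
  have Nx : 0 <= - x by rewrite oppr_ge0 ltW.
  have [n] := plin_nat_in Nr_mono Nx; have [m] := plin_nat_in lmono y0.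
  by have := lr m n; rewrite /Nr; lra.
Qed.

(** The cut is now the irrational one: its lower side goes to nonnegative values, its upper side to
    nonpositive ones. *)
Lemma unwind_End_sep : End_sep unwind.
Proof.
have Nr_bound y : ~~ `[< exists n, y < l n >] -> exists n, - y < Nr n.
  move=> /asboolPn ny; have [n [yl|ry]] := lr_cut y; first by case: ny; exists n.
  by exists n; rewrite ltrN2.
apply: (@rotation_End_sep (fun y => `[< exists n, y < l n >])).
- move=> x y xy /asboolP[n yn]; apply/asboolP; exists n; exact: le_lt_trans yn.
- move=> x y xy Dxy; rewrite /unwind Dxy.
  case: ifPn => [/asboolP[n yn]|]; last first.
    rewrite -Dxy => /Nr_bound[n xn]; rewrite lerN2.
    by apply: unwind_half_nondecr Nr_mono xn _; rewrite lerN2.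
  exact: unwind_half_nondecr lmono yn xy.
- move=> x y Dx Dy; rewrite /unwind Dx (negbTE Dy).
  have [n yn] := Nr_bound _ Dy; have /asboolP[m xm] := Dx.
  rewrite (le_trans _ (unwind_half_ge0 lmono xm))// oppr_le0.
  exact: unwind_half_ge0 Nr_mono yn.
Qed.
End Rotation.

(** * Finite support, and continuity of an isomorphism and its inverse *)

Lemma End_sep_comp f g : End_sep f -> End_sep g -> End_sep (f \o g).
Proof. by move=> fE gE x y z t /gE/fE. Qed.

Lemma finite_support (C : countType) (kappa : (rat -> rat) -> C) :
    (forall h f g, End_sep h -> End_sep f -> End_sep g ->
      kappa f = kappa g -> kappa (h \o f) = kappa (h \o g)) ->
  exists s : seq rat, forall f g, End_sep f -> End_sep g ->
    (forall x, x \in s -> f x = g x) -> kappa f = kappa g.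
Proof.
move=> kappaP; have [l [r [lmono rmono lr lr_cut]]] := irrational_cut.
have windE := wind_End_sep lmono rmono lr.
have unwindE := unwind_End_sep lmono rmono lr_cut.
have windKu := windK lmono rmono lr.
have windb := wind_bounded lmono rmono lr.
set w := wind l r in windE windKu windb; set u := unwind l r in unwindE windKu.
(* Coloring monotone [f] by the class of [f \o w] makes [e] finite-valued on an interval that
   contains the image of [w]. *)
have [h f g hm fm gm|e [s [emono eid _ ein]]] :=
    @collapse_interval C (fun f => kappa (f \o w)) _ (l 0%N - 1) (r 0%N + 1).
  by apply: (kappaP h (f \o w) (g \o w)); do ?apply: End_sep_comp => //;
    exact: nondecr_End_sep.
have eE := nondecr_End_sep emono.
have idE : kappa (u \o (e \o w)) = kappa idfun.
  rewrite (kappaP u (e \o w) w)//; last exact: End_sep_comp.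
  by congr kappa; apply/funext => x /=; rewrite windKu.
exists (map u s) => f g fE gE fg.
have ueE : End_sep (u \o (e \o w)) by apply/End_sep_comp => //; exact: End_sep_comp.
have iE : End_sep idfun by [].
rewrite -(kappaP f _ _ fE ueE iE idE) -(kappaP g _ _ gE ueE iE idE).
congr kappa; apply/funext => x /=; apply: fg.
by rewrite map_f// ein.
Qed.

Theorem theorem4p3 : automatic_homeomorphicity End_sep.
Proof.
move=> Omega N theta _ _ [theta_bij _ thetaM].
have [thetaN theta_inj theta_surj] := theta_bij.
have constE b : End_sep (cst b) by apply: nondecr_End_sep => x y.
split=> //.
  apply: within_cvg_Tr => f fE w.
  have [h g k hE gE kE|s sP] := @finite_support Omega (fun f => theta f w).
    by rewrite (thetaM h g)// (thetaM h k)//= => ->.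
  apply: filterS (nbhs_Tr_eq_on f s) => g /= gf gE.
  exact: sP.
have [w w_inj] : exists w, injective (fun b => theta (cst b) w).
  apply: contrapT => no.
  suff th01 : theta (cst 0) = theta (cst 1).
    have := theta_inj (cst 0) (cst 1).
    rewrite !inE => /(_ (constE 0) (constE 1) th01).
    by move=> /(congr1 (fun f => f 0)).
  apply/funext => w; apply: contrapT => w01; apply: no; exists w => b c.
  wlog bc : b c / b <= c.
    by move=> H; case: (leP b c) => [/H//|/ltW/H h /esym/h].
  move=> wbc; apply: contrapT => nbc; apply: w01.
  have {}bc : b < c by rewrite lt_neqAle bc andbT; apply/eqP.
  (* Composing with [k] turns a collision of [cst b] and [cst c] at [w] into one of [cst 0] and
     [cst 1]. *)
  pose k x : rat := if x <= b then 0 else 1.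
  have kE : End_sep k.
    apply: nondecr_End_sep => x y xy; rewrite /k; case: (leP y b) => yb.
      by rewrite (le_trans xy yb).
    by case: ifP.
  have kcst d : theta (cst (k d)) w = theta k (theta (cst d) w).
    by rewrite -[RHS]/((theta k \o theta (cst d)) w) -(thetaM k).
  have := kcst b; have := kcst c; rewrite wbc => <-.
  by rewrite /k lexx leNgt bc.
exists ('pinv_(fun=> idfun) End_sep theta) => [f fE|].
  by apply: pinvKV; rewrite ?inE.
apply: within_cvg_Tr => n Nn x.
have [f fE <-] := theta_surj n Nn.
have pinvE g : End_sep g -> 'pinv_(fun=> idfun) End_sep theta (theta g) = g.
  by move=> gE; apply: pinvKV; rewrite ?inE.
(* The value of [theta f] at this single point is [theta (cst (f x)) w], which determines [f x]. *)
apply: filterS (nbhs_Tr_eval (theta f) (theta (cst x) w)) => m /= mw Nm.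
have [g gE gm] := theta_surj m Nm.
rewrite -gm !pinvE// in mw *.
apply: w_inj => /=; move: mw.
rewrite -[LHS]/((theta g \o theta (cst x)) w).
rewrite -[RHS]/((theta f \o theta (cst x)) w).
by rewrite -(thetaM g)// -(thetaM f).
Qed.
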